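(* Consider the batch Lagrangian cut generation algorithm described in the context, applied to the problem $$(\mathrm{P})\qquad \min_{x}\Big\{c^{\top}x+\sum_{s\in S}p_s\,Q(x,s):\ x\in\bar X\Big\}.$$ (1) If $\epsilon>0$, then the algorithm terminates after a finite number of iterations and its output is an $\epsilon$-optimal solution of (P). (2) If $\epsilon=0$, then any accumulation point of the sequence $\{(\hat x_k,(\hat\theta_s^k)_{s\in S})\}_{k=1}^{\infty}$ of optimal solutions of the relaxed master programs $(RMP)_k$ generated by the algorithm is optimal for (P), where (P) is viewed in the variables $(x,(\theta_s)_{s\in S})$, i.e. as minimizing $c^\top x+\sum_{s\in S}p_s\theta_s$ subject to $x\in\bar X$ and $\pi^\top x+\theta_s\ge \bar Q_s(\pi,1)$ for all $\pi\in\Pi_s$, $s\in S$.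
   Context: **Data.** $S=\{1,\dots,m\}$ is a finite scenario set with probabilities $p_s$; $c\in\mathbb{R}^{n_1}$, $A\in\mathbb{R}^{m_1\times n_1}$, $b\in\mathbb{R}^{m_1}$; for each $s\in S$, $d_s\in\mathbb{R}^{n_2}$, $T^s\in\mathbb{R}^{m_2\times n_1}$, $W^s\in\mathbb{R}^{m_2\times n_2}$, $h^s\in\mathbb{R}^{m_2}$. Let $$X=\{x\in\mathbb{R}_+^{n_1-p_1}\times\mathbb{Z}_+^{p_1}: Ax=b\},\qquad \bar X=\{x\in\mathbb{R}_+^{n_1}:Ax=b\},$$ $$K^s=\{(x,y): x\in X,\ T^sx+W^sy\ge h^s,\ y\in\mathbb{R}_+^{n_2}\}.$$ Complete recourse is assumed: for every $x$ and $s$ there is $y\in\mathbb{R}_+^{n_2}$ with $W^sy\ge h^s-T^sx$. **Lagrangian cuts.** For $\pi\in\mathbb{R}^{n_1}$ let $\bar Q_s(\pi,1)=\min_{x,y}\{\pi^\top x+d_s^\top y:(x,y)\in K^s\}$ (the minimum is understood to exist). The Lagrangian cut $(\pi,1)$ for scenario $s$ is the inequality $\pi^\top x+\theta_s\ge\bar Q_s(\pi,1)$. For each $s$ a compact set $\Pi_s\subset\mathbb{R}^{n_1}$ is fixed, and $$Q(x,s)=\min\{\theta_s:\ \pi^\top x+\theta_s\ge\bar Q_s(\pi,1)\ \ \forall \pi\in\Pi_s\}.$$ **Algorithm.** Inputs: $\epsilon\ge 0$ and a partition $S=P_1\cup\dots\cup P_\tau$ into pairwise disjoint batches of a given batch size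 $\kappa$, $\tau=\lceil m/\kappa\rceil$. At iteration $k=1,2,\dots$: (i) Solve the relaxed master program $(RMP)_k$: minimize $c^\top x+\sum_{s}p_s\theta_s$ over $x\in\bar X$, $\theta_s\in\mathbb{R}$, subject to the finitely many Lagrangian cuts (with $\pi\in\Pi_s$) collected so far. Let $(\hat x_k,(\hat\theta^k_s)_{s\in S})$ be an optimal solution (assumed to exist). (ii) Choose a permutation $\sigma$ of $\{1,\dots,\tau\}$. For $t=1,2,\dots,\tau$ in turn: for each $s\in P_{\sigma(t)}$ solve the Lagrangian subproblem $\max_{\pi\in\Pi_s}\{\bar Q_s(\pi,1)-\pi^\top\hat x_k-\hat\theta_s^k\}$, let $\pi_s$ be an optimal solution, and add the cut $(\pi_s,1)$ for scenario $s$ to the master program; if then $$\sum_{s\in\bigcup_{i=1}^tP_{\sigma(i)}}p_s\big(\bar Q_s(\pi_s,1)-\pi_s^\top\hat x_k-\hat\theta_s^k\big)>\epsilon$$ (the stopping criterion), stop processing batches and go to iteration $k+1$, where $(RMP)_{k+1}$ is $(RMP)_k$ with all the added cuts. (iii) If all $\tau$ batches have been processed without the stopping criterion being met, terminate and return $\hat x_k$. **$\epsilon$-optimality.** Let $l_b^k=c^\top\hat x_k+\sum_sp_s\hat\theta_s^k$ and $u_b(x)=c^\top x+\sum_sp_sQ(x,s)$. The solution $\hat x_k$ is $\epsilon$-optimal if $u_b(\hat x_k)-l_b^k\le\epsilon$.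
   Formalization: Part (1) additionally assumes that X̄ is bounded; part (2) additionally assumes that the permutations starve no batch: each accumulation point of the iterates is also one of the iterates at which any given batch is processed. Without these both parts can fail. *)

(* Defs.v *)
From HB Require Import structures.
From mathcomp Require Import all_boot all_order all_algebra all_fingroup.
From mathcomp Require Import all_classical all_reals all_analysis.
Set Implicit Arguments.
Unset Strict Implicit.
Unset Printing Implicit Defensive.
Import Order.TTheory GRing.Theory Num.Theory.
Import numFieldNormedType.Exports.
(* ceil (m / kappa), for 0 < kappa *)
Definition nbatches (m kappa : nat) : nat := (m + kappa.-1) %/ kappa.

(* If kappa does not divide m, some batch has fewer than kappa elements. *)
Definition batch_partition (m kappa : nat)
    (P : 'I_(nbatches m kappa) -> {set 'I_m}) : Prop :=
  [/\ (0 < kappa)%N,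
      forall i, (#|P i| <= kappa)%N,
      forall i j, i != j -> [disjoint P i & P j]
    & (\bigcup_i P i)%SET = [set: 'I_m]%SET].

Local Open Scope classical_set_scope.
Local Open Scope ring_scope.

Definition dot (R : realType) (n : nat) (u v : 'cV[R]_n) : R :=
  \sum_j u j 0 * v j 0.

Definition lev (R : realType) (n : nat) (u v : 'cV[R]_n) : Prop :=
  forall j, u j 0 <= v j 0.

(* Two-stage stochastic integer program; the scenario set is 'I_m, and the
   last [nint] of the [n1] first-stage variables are the integer ones. *)
Record stoch_data (R : realType) (n1 n2 m1 m2 m : nat) := StochData {
  nint : nat;
  cost : 'cV[R]_n1;
  matA : 'M[R]_(m1, n1);
  rhsb : 'cV[R]_m1;
  prob : 'I_m -> R;
  vecd : 'I_m -> 'cV[R]_n2;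
  matT : 'I_m -> 'M[R]_(m2, n1);
  matW : 'I_m -> 'M[R]_(m2, n2);
  vech : 'I_m -> 'cV[R]_m2 }.

Section Problem.
Context {R : realType} {n1 n2 m1 m2 m : nat}.
Variable D : stoch_data R n1 n2 m1 m2 m.

Definition valid_data : Prop :=
  [/\ (nint D <= n1)%N, forall s, 0 <= prob D s & \sum_s prob D s = 1].

Definition Xbar : set 'cV[R]_n1 :=
  [set x | lev 0 x /\ matA D *m x = rhsb D].

Definition Xint : set 'cV[R]_n1 :=
  [set x | Xbar x /\
           forall j : 'I_n1, (n1 - nint D <= j)%N -> x j 0 \is a Num.int].

Definition Kset (s : 'I_m) : set ('cV[R]_n1 * 'cV[R]_n2) :=
  [set z | [/\ Xint z.1, lev (vech D s) (matT D s *m z.1 + matW D s *m z.2)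
             & lev 0 z.2]].

Definition complete_recourse : Prop :=
  forall (x : 'cV[R]_n1) (s : 'I_m), exists y : 'cV[R]_n2,
    lev 0 y /\ lev (vech D s - matT D s *m x) (matW D s *m y).

Definition lagr_obj (s : 'I_m) (pi : 'cV[R]_n1)
    (z : 'cV[R]_n1 * 'cV[R]_n2) : R :=
  dot pi z.1 + dot (vecd D s) z.2.

(* The infimum is a minimum under [Qbar_attained]. *)
Definition Qbar (s : 'I_m) (pi : 'cV[R]_n1) : R := inf (lagr_obj s pi @` Kset s).

Definition Qbar_attained (s : 'I_m) (pi : 'cV[R]_n1) : Prop :=
  exists2 z, Kset s z & forall z', Kset s z' -> lagr_obj s pi z <= lagr_obj s pi z'.

(* A point of the master problem is a pair (x, theta). The inequality is
   pi^T x + theta_s >= Qbar_s(pi, 1). *)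
Definition lagr_cut (s : 'I_m) (pi x : 'cV[R]_n1) (th : R) : Prop :=
  Qbar s pi <= dot pi x + th.

Definition master_feasible (C : 'I_m -> set 'cV[R]_n1) :
    set ('cV[R]_n1 * 'cV[R]_m) :=
  [set z : 'cV[R]_n1 * 'cV[R]_m | Xbar z.1 /\
           forall s pi, C s pi -> lagr_cut s pi z.1 (z.2 s 0)].

Definition master_obj (z : 'cV[R]_n1 * 'cV[R]_m) : R :=
  dot (cost D) z.1 + \sum_s prob D s * z.2 s 0.

(* With [C] the cuts collected so far this is optimality for the relaxed
   master program; with [C := Pi] it is optimality for the full problem (P)
   in the variables (x, theta). *)
Definition master_optimal (C : 'I_m -> set 'cV[R]_n1)
    (z : 'cV[R]_n1 * 'cV[R]_m) : Prop :=
  master_feasible C z /\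
  forall z', master_feasible C z' -> master_obj z <= master_obj z'.

Variable Pi : 'I_m -> set 'cV[R]_n1.

(* The infimum is a minimum as soon as pi |-> Qbar s pi - dot pi x has a
   maximum over [Pi s]. *)
Definition Qfun (x : 'cV[R]_n1) (s : 'I_m) : R :=
  inf [set th | forall pi, Pi s pi -> lagr_cut s pi x th].

Definition upper_bound (x : 'cV[R]_n1) : R :=
  dot (cost D) x + \sum_s prob D s * Qfun x s.

Definition eps_optimal (eps : R) (z : 'cV[R]_n1 * 'cV[R]_m) : Prop :=
  upper_bound z.1 - master_obj z <= eps.

End Problem.

(* The data produced by an execution; the k-th iteration (counted from 0) uses
   the k-th terms. The values after termination, and those of [dual k s] for
   scenarios [s] not processed at iteration k, are irrelevant. [init_cuts]
   are the cuts of the first relaxed master program: without any cut that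
   program is unbounded and has no optimal solution. *)
Record trace (R : realType) (n1 m tau : nat) := Trace {
  init_cuts : 'I_m -> seq 'cV[R]_n1;
  xhat : nat -> 'cV[R]_n1;
  thetahat : nat -> 'cV[R]_m;
  sigma : nat -> 'S_tau;
  dual : nat -> 'I_m -> 'cV[R]_n1 }.

Section Algorithm.
Context {R : realType} {n1 n2 m1 m2 m tau : nat}.
Variables (D : stoch_data R n1 n2 m1 m2 m) (Pi : 'I_m -> set 'cV[R]_n1).
Variables (P : 'I_tau -> {set 'I_m}) (eps : R) (r : trace R n1 m tau).

Definition iterate (k : nat) : 'cV[R]_n1 * 'cV[R]_m :=
  (xhat r k, thetahat r k).

Definition violation (k : nat) (s : 'I_m) (pi : 'cV[R]_n1) : R :=
  Qbar D s pi - dot pi (xhat r k) - thetahat r k s 0.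

(* Left-hand side of the stopping criterion after the first [t] batches. *)
Definition total_violation (k t : nat) : R :=
  \sum_(s in (\bigcup_(i : 'I_tau | (i < t)%N) P (sigma r k i))%SET)
     prob D s * violation k s (dual r k s).

(* The batch at position [i] of the permutation (counted from 0) is processed
   iff the criterion is not met after any smaller positive number of batches. *)
Definition reached (k : nat) (i : nat) : bool :=
  [forall t : 'I_i.+1, (0 < t)%N ==> (total_violation k t <= eps)].

Definition batch_processed (k : nat) (j : 'I_tau) : bool :=
  [exists i : 'I_tau, (sigma r k i == j) && reached k i].

Definition scenario_processed (k : nat) (s : 'I_m) : bool :=
  [exists j : 'I_tau, (s \in P j) && batch_processed k j].

(* All tau batches are processed and the criterion is never met. *)
Definition terminates_at (k : nat) : bool := reached k tau.

Fixpoint cuts (k : nat) : 'I_m -> seq 'cV[R]_n1 :=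
  if k is k'.+1 then
    fun s => if scenario_processed k' s then dual r k' s :: cuts k' s
             else cuts k' s
  else init_cuts r.

Definition valid_iteration (k : nat) : Prop :=
  master_optimal D (fun s => [set` cuts k s]) (iterate k) /\
  forall s, scenario_processed k s ->
    Pi s (dual r k s) /\
    forall pi, Pi s pi -> violation k s pi <= violation k s (dual r k s).

Definition active (k : nat) : Prop := forall l, (l < k)%N -> ~~ terminates_at l.

Definition is_run : Prop :=
  (forall s pi, pi \in init_cuts r s -> Pi s pi) /\
  (forall k, active k -> valid_iteration k).

(* The choice of the permutations does not starve a batch: near every
   accumulation point of the iterates, every batch is processed infinitely
   often. This holds if tau <= 1, and almost surely if the permutations are
   drawn independently and uniformly at random. Under an unrestricted choice,
   for eps = 0, the same batch can come first and meet the criterion at every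
   iteration, and then no cut is ever added for the scenarios of the others. *)
Definition no_batch_starved : Prop :=
  forall z, cluster (iterate @ \oo) z ->
  forall j, cluster (iterate @ within [set k | batch_processed k j] \oo) z.

End Algorithm.

(* Main.v *)
(** A cut generated at iteration k for scenario s is satisfied by all later
    iterates, and its normal lies in the compact set Pi s; hence if it is
    violated by v at iterate k, every later iterate differs from iterate k by
    at least a constant times v in some coordinate of (x, theta_s).

    For eps > 0, an iteration that does not terminate processes a scenario with
    violation greater than eps / (m + 1). If this happened forever, some scenario
    s would occur infinitely often; its (x, theta_s) are bounded (theta_s from
    below by the first cut for s, from above because the new cut is violated),
    so two of them would be arbitrarily close. For eps = 0, a cut of Pi s violated
    at an accumulation point z is violated by a fixed amount at the iterates close
    to z that process s, and a later iterate close to z gives the same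
    contradiction. Optimality of z then follows because each relaxed master
    program is a relaxation of the full problem. *)
Require Import Defs.
From HB Require Import structures.
From mathcomp Require Import all_boot all_order all_algebra all_fingroup.
From mathcomp Require Import all_classical all_reals all_analysis.
From mathcomp Require Import ring lra.
Set Implicit Arguments.
Unset Strict Implicit.
Unset Printing Implicit Defensive.
Import Order.TTheory GRing.Theory Num.Theory.
Import numFieldNormedType.Exports.
Local Open Scope classical_set_scope.
Local Open Scope ring_scope.

(** * Pigeonhole principle for bounded sequences *)

Lemma infinite_pigeonhole (T : finType) (A : nat -> Prop) (f : nat -> T) :
  (forall n, exists2 k, (n <= k)%N & A k) ->
  exists a, forall n, exists2 k, (n <= k)%N & A k /\ f k = a.
Proof.
move=> Ainf; apply: contrapT => /forallNP none.
have bound a : {n | forall k, (n <= k)%N -> A k -> f k <> a}.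
  apply: cid; apply: contrapT => /forallNP nobound; apply: (none a) => n.
  apply: contrapT => nok; apply: (nobound n) => k nk Ak fka.
  by apply: nok; exists k.
have [k nk Ak] := Ainf (\max_a sval (bound a))%N.
apply: (svalP (bound (f k)) k) => //.
by apply: leq_trans nk; apply: leq_bigmax.
Qed.

Lemma truncn_eq_dist_le (R : realType) (u v d : R) :
  0 < d -> 0 <= u -> 0 <= v -> Num.truncn (u / d) = Num.truncn (v / d) ->
  `|u - v| <= d.
Proof.
move=> d0 u0 v0 uv.
have /andP[lu uu] := truncn_itv (divr_ge0 u0 (ltW d0)).
have /andP[lv vv] := truncn_itv (divr_ge0 v0 (ltW d0)).
rewrite uv in lu uu.
move: lu uu lv vv; rewrite !ler_pdivlMr// !ltr_pdivrMr// -natr1 mulrDl mul1r.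
by move=> ? ? ? ?; rewrite ler_norml; apply/andP; split; lra.
Qed.

(** Shifted by [B], all values lie in an interval of length [B + B], cut into cells of length [d].
    There are finitely many families of cell indices, so one of them occurs infinitely often. *)
Lemma bounded_close_pair (R : realType) (I : finType) (A : nat -> Prop)
    (f : nat -> I -> R) (B d : R) :
  0 < d -> (forall n, exists2 k, (n <= k)%N & A k) ->
  (forall k i, A k -> `|f k i| <= B) ->
  exists k l, [/\ (k < l)%N, A k, A l & forall i, `|f k i - f l i| <= d].
Proof.
move=> d0 Ainf fB.
pose N := Num.truncn ((B + B) / d).
pose g k := [ffun i => inord (Num.truncn ((f k i + B) / d)) : 'I_N.+1].
have [a ainf] := infinite_pigeonhole g Ainf.
have [k _ [Ak gk]] := ainf 0%N; have [l kl [Al gl]] := ainf k.+1.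
have fB0 h i : A h -> 0 <= f h i + B.
  by move=> Ah; have := fB _ i Ah; rewrite ler_norml => /andP[? _]; lra.
have fN h i : A h -> (Num.truncn ((f h i + B) / d) < N.+1)%N.
  move=> Ah; rewrite ltnS; apply: le_truncn; rewrite ler_pM2r ?invr_gt0//.
  by move: (fB _ i Ah); rewrite ler_norml lerD2r => /andP[].
exists k, l; split=> // i.
have -> : f k i - f l i = (f k i + B) - (f l i + B) by ring.
apply: truncn_eq_dist_le; rewrite ?fB0//.
have /(congr1 val) : g k i = g l i by rewrite gk gl.
by rewrite !ffunE /= !inordK ?fN.
Qed.

(** * Coordinatewise estimates and accumulation points *)

Lemma coord_le_norm (R : realType) (n : nat) (x : 'cV[R]_n) j :
  `|x j 0| <= `|x|.
Proof.
rewrite [leRHS]/Num.norm/= mx_normrE.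
exact: (le_bigmax _ (fun ij => `|x ij.1 ij.2|) (j, 0)).
Qed.

Lemma bounded_set_coord (R : realType) (n : nat) (A : set 'cV[R]_n) :
  bounded_set A -> exists2 M, 0 <= M & forall x j, A x -> `|x j 0| <= M.
Proof.
case=> M0 [_ hM].
exists (`|M0| + 1) => [|x j Ax]; first by rewrite addr_ge0.
apply: le_trans (coord_le_norm x j) _.
by apply: hM => //; rewrite (le_lt_trans (ler_norm _))// ltrDl.
Qed.

(** Balls in these spaces are coordinatewise. The filter is arbitrary so that it can also be [\oo]
    restricted to the iterations processing a given batch. *)
Lemma cluster_coord (R : realType) (n m : nat)
    (u : nat -> 'cV[R]_n * 'cV[R]_m) (F : set_system nat) {FF : Filter F}
    (z : 'cV[R]_n * 'cV[R]_m) (e : R) (A : set nat) :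
  cluster (u @ F) z -> 0 < e -> F A ->
  exists k, [/\ A k, forall j, `|(u k).1 j 0 - z.1 j 0| <= e
                   & forall j, `|(u k).2 j 0 - z.2 j 0| <= e].
Proof.
move=> uz e0 FA.
have FuA : (u @ F) (u @` A).
  by rewrite /nbhs/=; apply: (@filterS _ F _ A) => // k Ak; exists k.
have [w [[k Ak <-] [[_ h1] [_ h2]]]] := uz _ _ FuA (nbhsx_ballx z e e0).
exists k; split=> // j.
  by rewrite distrC ltW//; apply: h1.
by rewrite distrC ltW//; apply: h2.
Qed.

(** Non-strict inequalities pass to accumulation points; a linear error bound around [z] stands in
    for continuity. *)
Lemma cluster_le (R : realType) (n m : nat)
    (u : nat -> 'cV[R]_n * 'cV[R]_m) (F : set_system nat) {FF : Filter F}
    (z : 'cV[R]_n * 'cV[R]_m) (f : 'cV[R]_n * 'cV[R]_m -> R) (L a : R) :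
  cluster (u @ F) z -> 0 <= L ->
  (forall (w : 'cV[R]_n * 'cV[R]_m) e, 0 <= e -> (forall j, `|w.1 j 0 - z.1 j 0| <= e) ->
    (forall j, `|w.2 j 0 - z.2 j 0| <= e) -> `|f w - f z| <= L * e) ->
  (forall k, f (u k) <= a) -> f z <= a.
Proof.
move=> uz L0 fL fua; rewrite leNgt; apply/negP => afz.
(* Dividing by [L + 1] instead of [L] covers [L = 0] and makes the final inequality strict. *)
have L1 : 0 < L + 1 by rewrite ltr_wpDl.
pose e := (f z - a) / (L + 1).
have e0 : 0 < e by rewrite divr_gt0// subr_gt0.
have [k [_ h1 h2]] := cluster_coord uz e0 filterT.
have /ler_normlP[+ _] := fL _ _ (ltW e0) h1 h2.
have eE : (L + 1) * e = f z - a by rewrite mulrC divfK// gt_eqF.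
by move: (fua k) => ? ?; nra.
Qed.

Lemma dot_dist (R : realType) (n : nat) (pi x y : 'cV[R]_n) (M e : R) :
  0 <= M -> 0 <= e -> (forall j, `|pi j 0| <= M) ->
  (forall j, `|x j 0 - y j 0| <= e) ->
  `|dot pi x - dot pi y| <= n%:R * M * e.
Proof.
move=> M0 e0 piM xy.
rewrite /dot -sumrB (le_trans (ler_norm_sum _ _ _))//.
have -> : n%:R * M * e = \sum_(j < n) M * e.
  by rewrite sumr_const card_ord -mulrA mulr_natl.
by apply: ler_sum => j _; rewrite -mulrBr normrM ler_pM.
Qed.

Lemma dot_bound (R : realType) (n : nat) (pi x : 'cV[R]_n) (M e : R) :
  0 <= M -> 0 <= e -> (forall j, `|pi j 0| <= M) ->
  (forall j, `|x j 0| <= e) -> `|dot pi x| <= n%:R * M * e.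
Proof.
move=> M0 e0 piM xe; have := @dot_dist _ _ pi x 0 _ _ M0 e0 piM.
have -> : dot pi 0 = 0 by rewrite /dot big1// => j _; rewrite mxE mulr0.
by rewrite subr0; apply => j; rewrite mxE subr0.
Qed.

(** * Recourse values, master objective and closedness of the feasible set *)

(** The cut of a maximizing [pi] implies all the others, so the admissible [th] form a closed
    half-line. *)
Lemma Qfun_max (R : realType) (n1 n2 m1 m2 m : nat)
    (D : stoch_data R n1 n2 m1 m2 m) (Pi : 'I_m -> set 'cV[R]_n1) x s pi :
  Pi s pi ->
  (forall pi', Pi s pi' -> Qbar D s pi' - dot pi' x <= Qbar D s pi - dot pi x) ->
  Qfun D Pi x s = Qbar D s pi - dot pi x.
Proof.
move=> Pipi pimax; apply/eqP; rewrite eq_le; apply/andP; split.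
  apply: ge_inf => [|pi' /pimax]; last by rewrite /lagr_cut; lra.
  by exists (Qbar D s pi - dot pi x) => th /(_ _ Pipi); rewrite /lagr_cut; lra.
apply: lb_le_inf => [|th /(_ _ Pipi)]; last by rewrite /lagr_cut; lra.
by exists (Qbar D s pi - dot pi x) => pi' /pimax; rewrite /lagr_cut; lra.
Qed.

(** Attainment provides the lower bound without which [inf] would be a default value. *)
Lemma Qbar_le_obj (R : realType) (n1 n2 m1 m2 m : nat)
    (D : stoch_data R n1 n2 m1 m2 m) s pi z :
  Qbar_attained D s pi -> Kset D s z -> Qbar D s pi <= lagr_obj D s pi z.
Proof.
move=> [z0 _ z0min] Kz; apply: ge_inf; last by exists z.
by exists (lagr_obj D s pi z0) => _ [z' /z0min ? <-].
Qed.

Lemma master_obj_dist (R : realType) (n1 n2 m1 m2 m : nat)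
    (D : stoch_data R n1 n2 m1 m2 m) (w z : 'cV[R]_n1 * 'cV[R]_m) e :
  0 <= e -> (forall j, `|w.1 j 0 - z.1 j 0| <= e) ->
  (forall j, `|w.2 j 0 - z.2 j 0| <= e) ->
  `|master_obj D w - master_obj D z| <=
    (n1%:R * `|cost D| + m%:R * `|\col_s prob D s|) * e.
Proof.
move=> e0 h1 h2.
have objE v : master_obj D v = dot (cost D) v.1 + dot (\col_s prob D s) v.2.
  by congr (_ + _); apply: eq_bigr => s _; rewrite mxE.
rewrite !objE opprD addrACA mulrDl (le_trans (ler_normD _ _))// lerD//.
  by apply: dot_dist => // j; apply: coord_le_norm.
by apply: dot_dist => // j; apply: coord_le_norm.
Qed.

Lemma Xbar_cluster (R : realType) (n1 n2 m1 m2 m p : nat)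
    (D : stoch_data R n1 n2 m1 m2 m) (u : nat -> 'cV[R]_n1 * 'cV[R]_p)
    (F : set_system nat) {FF : Filter F} (z : 'cV[R]_n1 * 'cV[R]_p) :
  cluster (u @ F) z -> (forall k, Xbar D (u k).1) -> Xbar D z.1.
Proof.
move=> uz uX; split=> [j|].
  rewrite mxE -oppr_le0.
  apply: (@cluster_le _ _ _ u F _ z (fun w => - w.1 j 0) 1) => //.
    by move=> w e e0 h _; rewrite mul1r -opprD normrN.
  by move=> k; rewrite oppr_le0; have [/(_ j)] := uX k; rewrite mxE.
apply/colP => i.
have mulE (v : 'cV[R]_n1) : (matA D *m v) i 0 = dot (row i (matA D))^T v.
  by rewrite mxE; apply: eq_bigr => j _; rewrite !mxE.
have dist e (w : 'cV[R]_n1 * 'cV[R]_p) : 0 <= e ->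
    (forall j, `|w.1 j 0 - z.1 j 0| <= e) ->
    `|(matA D *m w.1) i 0 - (matA D *m z.1) i 0| <=
      n1%:R * `|(row i (matA D))^T| * e.
  by move=> *; rewrite !mulE; apply: dot_dist => // j; apply: coord_le_norm.
apply/eqP; rewrite eq_le; apply/andP; split.
  apply: (@cluster_le _ _ _ u F _ z (fun w => (matA D *m w.1) i 0)
            (n1%:R * `|(row i (matA D))^T|)) => //.
    by move=> w e e0 h _; apply: dist.
  by move=> k; have [_ ->] := uX k.
rewrite -lerN2.
apply: (@cluster_le _ _ _ u F _ z (fun w => - (matA D *m w.1) i 0)
          (n1%:R * `|(row i (matA D))^T|)) => //.
  by move=> w e e0 h _; rewrite -opprD normrN; apply: dist.
by move=> k; have [_ ->] := uX k.
Qed.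

(** * Analysis of a single iteration and of the collected cuts *)

Lemma total_violation_terminates (R : realType) (n1 n2 m1 m2 m tau : nat)
    (D : stoch_data R n1 n2 m1 m2 m) (P : 'I_tau -> {set 'I_m})
    (eps : R) (r : trace R n1 m tau) k :
  (\bigcup_i P i)%SET = [set: 'I_m]%SET -> 0 <= eps ->
  terminates_at D P eps r k ->
  \sum_s prob D s * violation D r k s (dual r k s) <= eps.
Proof.
move=> Pcover eps0 /forallP/(_ ord_max)/implyP/=.
have -> : \sum_s prob D s * violation D r k s (dual r k s) =
    total_violation D P r k tau.
  rewrite /total_violation; apply: eq_bigl => s; apply/esym/bigcupP.
  have : s \in (\bigcup_i P i)%SET by rewrite Pcover inE.
  move=> /bigcupP[j _ sPj]; exists ((sigma r k)^-1 j)%g; first by [].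
  by rewrite permKV.
(* With no batch the criterion is never tested, but the sum is empty and [0 <= eps] suffices. *)
have [tau0 _|tau0 -> //] := posnP tau.
rewrite /total_violation big_pred0// => s.
by apply/bigcupP => -[i]; have := ltn_ord i; rewrite [X in (_ < X)%N -> _]tau0.
Qed.

Lemma terminates_all_processed (R : realType) (n1 n2 m1 m2 m tau : nat)
    (D : stoch_data R n1 n2 m1 m2 m) (P : 'I_tau -> {set 'I_m})
    (eps : R) (r : trace R n1 m tau) k s :
  (\bigcup_i P i)%SET = [set: 'I_m]%SET ->
  terminates_at D P eps r k -> scenario_processed D P eps r k s.
Proof.
move=> Pcover /forallP term.
have : s \in (\bigcup_i P i)%SET by rewrite Pcover inE.
move=> /bigcupP[j _ sPj]; apply/existsP; exists j; rewrite sPj /=.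
apply/existsP; exists ((sigma r k)^-1 j)%g; rewrite permKV eqxx /=.
apply/forallP => t.
have le_t : (t < tau.+1)%N.
  by apply/ltnW/(leq_trans (ltn_ord t)).
by have := term (Ordinal le_t).
Qed.

Lemma not_terminates_violated (R : realType) (n1 n2 m1 m2 m tau : nat)
    (D : stoch_data R n1 n2 m1 m2 m) (P : 'I_tau -> {set 'I_m})
    (eps : R) (r : trace R n1 m tau) k :
  valid_data D -> 0 < eps -> ~~ terminates_at D P eps r k ->
  exists s, scenario_processed D P eps r k s /\
    eps / m.+1%:R < violation D r k s (dual r k s).
Proof.
move=> [_ p0 p1] eps0 nterm.
(* Minimality of [t] ensures that the first [t] batches are really processed. *)
have /ex_minnP[t /andP[t0 epst] tmin] :
    exists t, (0 < t)%N && (eps < total_violation D P r k t).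
  move: nterm; rewrite negb_forall => /existsP[t].
  by rewrite negb_imply -ltNge => ht; exists t.
have processed s : s \in (\bigcup_(i : 'I_tau | (i < t)%N) P (sigma r k i))%SET ->
    scenario_processed D P eps r k s.
  move=> /bigcupP[i it sP]; apply/existsP; exists (sigma r k i).
  rewrite sP; apply/existsP; exists i; rewrite eqxx.
  apply/forallP => t'; apply/implyP => t'0; rewrite leNgt; apply/negP => epst'.
  have := tmin t'; rewrite t'0 epst' => /(_ isT).
  by rewrite leqNgt (leq_trans (ltn_ord t')).
have [s [sS large]] : exists s,
    s \in (\bigcup_(i : 'I_tau | (i < t)%N) P (sigma r k i))%SET /\
    eps / m.+1%:R < prob D s * violation D r k s (dual r k s).
  (* Averaging: if all terms were at most [eps / m.+1%:R], at most [m] of them could not exceed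
     [eps]. *)
  apply: contrapT => /forallNP small; move: epst; apply/negP; rewrite -leNgt.
  rewrite /total_violation.
  apply: (@le_trans _ _ (\sum_(s : 'I_m) eps / m.+1%:R)).
    rewrite big_mkcond; apply: ler_sum => s _; case: ifPn => sS.
      by rewrite leNgt; apply/negP => large; apply: (small s).
    by rewrite divr_ge0 ?ltW.
  rewrite sumr_const card_ord -[leLHS]mulr_natr mulrAC ler_pdivrMr//.
  by rewrite ler_pM2l// ler_nat.
exists s; split; first exact: processed.
have ps1 : prob D s <= 1.
  by rewrite -p1 (bigD1 s)//= lerDl sumr_ge0.
have eta0 : 0 < eps / m.+1%:R :> R by rewrite divr_gt0.
(* The sign is what allows dropping the factor [prob D s <= 1]. *)
have v0 : 0 <= violation D r k s (dual r k s).
  rewrite leNgt; apply/negP => /ltW /(mulr_ge0_le0 (p0 s)) pv0.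
  by have := lt_trans eta0 (lt_le_trans large pv0); rewrite ltxx.
exact/(lt_le_trans large)/ler_piMl.
Qed.

Lemma dual_in_cuts (R : realType) (n1 n2 m1 m2 m tau : nat)
    (D : stoch_data R n1 n2 m1 m2 m) (P : 'I_tau -> {set 'I_m})
    (eps : R) (r : trace R n1 m tau) k l s :
  (k < l)%N -> scenario_processed D P eps r k s ->
  dual r k s \in cuts D P eps r l s.
Proof.
elim: l => // l IHl; rewrite ltnS leq_eqVlt => /predU1P[-> pk|kl pk] /=.
  by rewrite pk mem_head.
by case: ifP => _; rewrite ?inE IHl ?orbT.
Qed.

Lemma cuts_sub (R : realType) (n1 n2 m1 m2 m tau : nat)
    (D : stoch_data R n1 n2 m1 m2 m) (Pi : 'I_m -> set 'cV[R]_n1)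
    (P : 'I_tau -> {set 'I_m}) (eps : R) (r : trace R n1 m tau) k s pi :
  is_run D Pi P eps r -> active D P eps r k ->
  pi \in cuts D P eps r k s -> Pi s pi.
Proof.
move=> [init valid]; elim: k => [_|k IHk act /=]; first exact: init.
have actk : active D P eps r k by move=> l /ltnW; apply: act.
case: ifP => [pk|_]; last exact: IHk.
rewrite inE => /predU1P[->|]; last exact: IHk.
by have [_ /(_ s pk)[]] := valid k actk.
Qed.

(** The cut generated at [k] holds at iterate [l], so its violation at [k] is at most the change of
    its left-hand side between the two iterates. *)
Lemma violation_le_dist (R : realType) (n1 n2 m1 m2 m tau : nat)
    (D : stoch_data R n1 n2 m1 m2 m) (Pi : 'I_m -> set 'cV[R]_n1)
    (P : 'I_tau -> {set 'I_m}) (eps : R) (r : trace R n1 m tau) k l s M e :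
  valid_iteration D Pi P eps r l -> (k < l)%N ->
  scenario_processed D P eps r k s -> 0 <= M -> 0 <= e ->
  (forall j, `|dual r k s j 0| <= M) ->
  (forall j, `|xhat r k j 0 - xhat r l j 0| <= e) ->
  `|thetahat r k s 0 - thetahat r l s 0| <= e ->
  violation D r k s (dual r k s) <= (n1%:R * M + 1) * e.
Proof.
move=> [[[_ feas] _] _] kl pk M0 e0 dM hx /ler_normlP[hth _].
have := feas s _ (dual_in_cuts kl pk).
rewrite /lagr_cut /violation /=.
have /ler_normlP[hdot _] := dot_dist M0 e0 dM hx.
by move: hth hdot; rewrite mulrDl mul1r; lra.
Qed.

(** The first-stage costs cancel, and each [Qfun] is attained at the computed dual; the gap is thus
    bounded by the total violation. *)
Lemma terminates_eps_optimal (R : realType) (n1 n2 m1 m2 m tau : nat)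
    (D : stoch_data R n1 n2 m1 m2 m) (Pi : 'I_m -> set 'cV[R]_n1)
    (P : 'I_tau -> {set 'I_m}) (eps : R) (r : trace R n1 m tau) k :
  (\bigcup_i P i)%SET = [set: 'I_m]%SET -> 0 <= eps ->
  valid_iteration D Pi P eps r k -> terminates_at D P eps r k ->
  eps_optimal D Pi eps (iterate r k).
Proof.
move=> Pcover eps0 [_ valid] term.
apply: le_trans (total_violation_terminates Pcover eps0 term).
rewrite /upper_bound /master_obj /= opprD addrACA subrr add0r -sumrB.
apply: ler_sum => s _; rewrite -mulrBr.
have [Pis smax] := valid s (terminates_all_processed s Pcover term).
rewrite (Qfun_max Pis)// => pi /smax.
by rewrite /violation; lra.
Qed.

(** * Finite termination for positive tolerance *)

Lemma finite_termination (R : realType) (n1 n2 m1 m2 m tau : nat)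
    (D : stoch_data R n1 n2 m1 m2 m) (Pi : 'I_m -> set 'cV[R]_n1)
    (P : 'I_tau -> {set 'I_m}) (eps : R) (r : trace R n1 m tau) :
  valid_data D -> (forall s, compact (Pi s)) ->
  (forall s pi, Pi s pi -> Qbar_attained D s pi) ->
  0 < eps -> bounded_set (Xbar D) -> is_run D Pi P eps r ->
  exists k, terminates_at D P eps r k.
Proof.
move=> hD Pic Qatt eps0 /bounded_set_coord[B B0 XB] run.
apply: contrapT => /forallNP noterm.
have act k : active D P eps r k by move=> l _; apply/negP.
have valid k : valid_iteration D Pi P eps r k by apply: (proj2 run).
pose eta := eps / m.+1%:R.
have eta0 : 0 < eta by rewrite divr_gt0.
have /choice[sel selP] k : exists s, scenario_processed D P eps r k s /\
    eta < violation D r k s (dual r k s).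
  by apply: not_terminates_violated => //; apply/negP.
have [s sinf] : exists s, forall n, exists2 k, (n <= k)%N & True /\ sel k = s.
  by apply: infinite_pigeonhole => n; exists n.
have sproc k : sel k = s -> [/\ scenario_processed D P eps r k s,
    Pi s (dual r k s) & eta < violation D r k s (dual r k s)].
  by move=> <-; have [pk ?] := selP k; have [_ /(_ _ pk)[]] := valid k.
have [k0 _ [_ /sproc[pk0 Pik0 _]]] := sinf 0%N.
have [M M0 PiM] := bounded_set_coord (compact_bounded (Pic s)).
(* [Kset] does not depend on the dual, so this one point bounds [Qbar] from above for every dual in
   [Pi s]. *)
have [[x0 y0] Kz0 _] := Qatt _ _ Pik0.
have xB k j : `|xhat r k j 0| <= B.
  by apply: XB; have [[[]]] := valid k.
have x0B j : `|x0 j 0| <= B by apply: XB; have [[]] := Kz0.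
have dotB pi (x : 'cV_n1) : Pi s pi -> (forall j, `|x j 0| <= B) ->
    `|dot pi x| <= n1%:R * M * B.
  by move=> Pis xle; apply: dot_bound => // j; apply: PiM.
(* The first three terms bound [thetahat] from above, through the violated cut and [(x0, y0)]; the
   cut of iteration [k0] bounds it from below. *)
pose T := n1%:R * M * B + n1%:R * M * B + `|dot (vecd D s) y0|
          + `|Qbar D s (dual r k0 s)|.
have thT k : (k0 < k)%N -> sel k = s -> `|thetahat r k s 0| <= T.
  move=> k0k /sproc[_ Pik viol].
  have [[[_ feas] _] _] := valid k.
  have := feas s _ (dual_in_cuts k0k pk0); rewrite /lagr_cut /=.
  have := Qbar_le_obj (Qatt _ _ Pik) Kz0; rewrite /lagr_obj /=.
  move: viol; rewrite /violation.
  have /ler_normlP[? ?] := dotB _ _ Pik (xB k).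
  have /ler_normlP[? ?] := dotB _ _ Pik x0B.
  have /ler_normlP[? ?] := dotB _ _ Pik0 (xB k).
  have /ler_normlP[? ?] := lexx `|dot (vecd D s) y0|.
  have /ler_normlP[? ?] := lexx `|Qbar D s (dual r k0 s)|.
  by move=> ? ? ?; rewrite /T ler_norml; apply/andP; split; lra.
have C0 : 0 < n1%:R * M + 1 by rewrite ltr_wpDl// mulr_ge0.
have d0 : 0 < eta / (n1%:R * M + 1) by rewrite divr_gt0.
(* The index [None] stands for the theta coordinate of [s]. *)
pose f k (i : option 'I_n1) :=
  if i is Some j then xhat r k j 0 else thetahat r k s 0.
have [|k i [k0k ks]|k [l [kl [_ ks] _ close]]] :=
  @bounded_close_pair R _ (fun k => (k0 < k)%N /\ sel k = s) f (B + T) _ d0.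
(* Only iterations strictly after [k0] have its cut in their master program. *)
- move=> n; have [k nk [_ ks]] := sinf (maxn n k0.+1).
  by move: nk; rewrite geq_max => /andP[? ?]; exists k.
- have T0 := le_trans (normr_ge0 _) (thT k k0k ks).
  case: i => [j|] /=; first by have := xB k j; lra.
  by have := thT k k0k ks; lra.
have [pk Pik] := sproc k ks; apply/negP; rewrite -leNgt.
rewrite -(divfK (lt0r_neq0 C0) eta) mulrC.
apply: (violation_le_dist (valid l) kl pk) => //.
- exact: ltW.
- by move=> j; apply: PiM.
- by move=> j; apply: (close (Some j)).
- exact: (close None).
Qed.

(** * Accumulation points for zero tolerance *)

Lemma cluster_master_feasible (R : realType) (n1 n2 m1 m2 m tau : nat)
    (D : stoch_data R n1 n2 m1 m2 m) (Pi : 'I_m -> set 'cV[R]_n1)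
    (P : 'I_tau -> {set 'I_m}) (eps : R) (r : trace R n1 m tau) z :
  (forall s, compact (Pi s)) -> (\bigcup_i P i)%SET = [set: 'I_m]%SET ->
  (forall k, valid_iteration D Pi P eps r k) ->
  no_batch_starved D P eps r -> cluster (iterate r @ \oo) z ->
  master_feasible D Pi z.
Proof.
move=> Pic Pcover valid fair rz; split.
  by apply: (Xbar_cluster rz) => k; have [[[]]] := valid k.
move=> s pi Pis.
have : s \in (\bigcup_i P i)%SET by rewrite Pcover inE.
move=> /bigcupP[j _ sPj].
have [M M0 PiM] := bounded_set_coord (compact_bounded (Pic s)).
have C0 : 0 < n1%:R * M + 1 by rewrite ltr_wpDl// mulr_ge0.
rewrite /lagr_cut leNgt; apply/negP => cutz.
(* Let [v] be the violation at [z]. With this [e], the violation of [pi] at [k] is at least [3v/4],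
   while that of the computed dual is at most [v/2], against its maximality. *)
pose e := (Qbar D s pi - dot pi z.1 - z.2 s 0) / (4 * (n1%:R * M + 1)).
have e0 : 0 < e by rewrite divr_gt0 ?mulr_gt0//; lra.
have eE : 4 * ((n1%:R * M + 1) * e) = Qbar D s pi - dot pi z.1 - z.2 s 0.
  by rewrite mulrA mulrC divfK// mulf_neq0// gt_eqF.
have [k [batchk kx kth]] : exists k, [/\ batch_processed D P eps r k j,
    forall j, `|(iterate r k).1 j 0 - z.1 j 0| <= e
    & forall j, `|(iterate r k).2 j 0 - z.2 j 0| <= e].
  (* The absence of starvation gives an iterate near [z] at which the batch of [s] is processed. *)
  have batch : within [set k | batch_processed D P eps r k j] \oo
                 [set k | batch_processed D P eps r k j] by apply: withinT.
  exact: (cluster_coord (fair z rz j) e0 batch).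
have pk : scenario_processed D P eps r k s by apply/existsP; exists j; rewrite sPj.
have [l [kl lx lth]] := cluster_coord rz e0 (nbhs_infty_gt k).
have [Pik kmax] := proj2 (valid k) s pk.
have e20 : 0 <= e + e by lra.
have upper : violation D r k s (dual r k s) <= (n1%:R * M + 1) * (e + e).
  have close (a b c : R) : `|a - c| <= e -> `|b - c| <= e -> `|a - b| <= e + e.
    by move=> ac bc; rewrite (le_trans (ler_distD c _ _))// lerD// distrC.
  apply: (violation_le_dist (valid l) kl pk) => //.
  - by move=> i; apply: PiM.
  - by move=> i; apply: close (kx i) (lx i).
  - exact: close (kth s) (lth s).
have := kmax pi Pis.
have /ler_normlP[_ xdot] := dot_dist M0 (ltW e0) (fun i => PiM pi i Pis) kx.
have /ler_normlP[_ xth] := kth s.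
move: upper cutz eE xdot xth; rewrite /violation /= mulrDr mulrDl mul1r.
set Ce := n1%:R * M * e.
have Ce0 : 0 <= Ce by apply: mulr_ge0 (ltW e0); apply: mulr_ge0.
by lra.
Qed.
Unset Implicit Arguments.

Theorem theorem3p6 (R : realType) (n1 n2 m1 m2 m kappa : nat)
    (D : stoch_data R n1 n2 m1 m2 m)
    (Pi : 'I_m -> set 'cV[R]_n1)
    (P : 'I_(nbatches m kappa) -> {set 'I_m})
    (hD : valid_data D)
    (hrec : complete_recourse D)
    (hPi : forall s, compact (Pi s))
    (hQbar : forall s pi, Pi s pi -> Qbar_attained D s pi)
    (hP : batch_partition P) :
  (forall (eps : R) (r : trace R n1 m (nbatches m kappa)),
     0 < eps -> bounded_set (Xbar D) -> is_run D Pi P eps r ->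
     exists k : nat,
       [/\ active D P eps r k, terminates_at D P eps r k
         & eps_optimal D Pi eps (iterate r k)])
  /\
  (forall r : trace R n1 m (nbatches m kappa),
     is_run D Pi P 0 r -> (forall k, ~~ terminates_at D P 0 r k) ->
     no_batch_starved D P 0 r ->
     forall z : 'cV[R]_n1 * 'cV[R]_m,
       cluster (iterate r @ \oo) z -> master_optimal D Pi z).
Proof.
have [_ _ _ Pcover] := hP; split.
  move=> eps r eps0 Xbnd run.
  (* The least terminating index is still active, so its iteration is valid. *)
  have [|k term kmin] := @ex_minnP (terminates_at D P eps r).
    exact: finite_termination run.
  have act : active D P eps r k.
    by move=> l; apply: contraTN => /kmin; rewrite leqNgt.
  exists k; split=> //.
  exact: (terminates_eps_optimal Pcover (ltW eps0) (proj2 run k act)).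
move=> r run noterm fair z rz.
have act k : active D P 0 r k by [].
have valid k : valid_iteration D Pi P 0 r k by apply: (proj2 run).
split; first exact: (cluster_master_feasible hPi Pcover valid fair rz).
move=> z' [Xz' cutz'].
(* All collected cuts come from [Pi], so [z'] is feasible for every relaxed master program and
   bounds its optimal value; the bound passes to [z]. *)
apply: (cluster_le rz _ (@master_obj_dist _ _ _ _ _ _ D ^~ z)) => // k.
have [[_ kopt] _] := valid k.
by apply: kopt; split=> // s pi /(cuts_sub run (act k)); apply: cutz'.
Qed.
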